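(* Let $A_i\subseteq\mathbb{R}^{n_i}$ be given for $i=1,\dots,I$, and consider the two identities $$\text{(T)}\quad T_{A_1\times\cdots\times A_I}(z_1,\dots,z_I)= T_{A_1}(z_1)\times\cdots\times T_{A_I}(z_I),$$ $$\text{(N)}\quad N_{A_1\times\cdots\times A_I}\big((z_1,\dots,z_I);(d_1,\dots,d_I)\big)= N_{A_1}(z_1;d_1)\times\cdots\times N_{A_I}(z_I;d_I).$$ (i) If $A_i$ is regular at $z_i\in A_i$ in direction $d_i\in\mathbb{R}^{n_i}$ for $i=1,\dots,I$, then $A_1\times\cdots\times A_I$ is regular at $(z_1,\dots,z_I)$ in direction $(d_1,\dots,d_I)$; moreover (N) holds. (ii) If $A_i$ is directionally regular at $z_i\in A_i$ for $i=1,\dots,I$, then $A_1\times\cdots\times A_I$ is directionally regular at $(z_1,\dots,z_I)$; moreover (T) holds, and (N) holds for all $d_i\in\mathbb{R}^{n_i}$. (iii) If $A_i$ is closed and convex for $i=1,\dots,I$, then $A_1\times\cdots\times A_I$ is directionally regular; moreover (T) and (N) hold for all $z_i\in A_i$ and all $d_i\in\mathbb{R}^{n_i}$.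
   Context: For $C\subseteq\mathbb{R}^n$ and $z\in C$: $T_C(z)=\{u:\exists t_k\downarrow 0,\ u_k\to u \text{ with } z+t_ku_k\in C\ \forall k\}$ ($t_k\downarrow0$ means $t_k>0$, $t_k\to0$). The regular (Fréchet) normal cone is $\widehat N_C(z)=\{v:\langle v,z'-z\rangle\le o(\|z'-z\|)\ \forall z'\in C\}$ for $z\in C$, and $\widehat N_C(z)=\emptyset$ for $z\notin C$. The directional limiting normal cone is $N_C(z;d)=\{v:\exists t_k\downarrow0,\ d_k\to d,\ v_k\to v\text{ with }v_k\in\widehat N_C(z+t_kd_k)\ \forall k\}$, and the inner directional limiting normal cone is $N^i_C(z;d)=\{v:\forall t_k\downarrow0\ \exists d_k\to d,\ v_k\to v\text{ with }v_k\in\widehat N_C(z+t_kd_k)\ \forall k\}$. $C$ is regular at $z$ in direction $d$ if $N_C(z;d)=N_C^i(z;d)$; directionally regular at $z$ if this holds for all $d$; directionally regular if it is directionally regular at every $z\in C$. *)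

(* Defs.v *)
From HB Require Import structures.
From mathcomp Require Import all_boot all_order all_algebra.
From mathcomp Require Import all_classical all_reals all_analysis.

Set Implicit Arguments.
Unset Strict Implicit.
Unset Printing Implicit Defensive.

Import Order.TTheory GRing.Theory Num.Theory.
Import numFieldNormedType.Exports.

Local Open Scope classical_set_scope.
Local Open Scope ring_scope.

Definition dot (R : realType) (n : nat) (u v : 'rV[R]_n) : R :=
  \sum_(i < n) u 0 i * v 0 i.

(* The library norm on ['rV[R]_n] is the sup norm, so the Euclidean norm is
   introduced separately; the library topology is the usual one of R^n. *)
Definition enorm (R : realType) (n : nat) (u : 'rV[R]_n) : R :=
  Num.sqrt (dot u u).

Definition decreases_to0 (R : realType) (t : nat -> R) : Prop :=
  (forall k, 0 < t k) /\ t @ \oo --> (0 : R).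

Definition tangent_cone (R : realType) (n : nat) (C : set 'rV[R]_n)
    (z : 'rV[R]_n) : set 'rV[R]_n :=
  [set u | exists (t : nat -> R) (w : nat -> 'rV[R]_n),
     [/\ decreases_to0 t, w @ \oo --> u & forall k, C (z + t k *: w k)]].

(* [<v, z' - z> <= o(|z' - z|)] for z' in C, that is
   [limsup <v, z' - z> / |z' - z| <= 0] as z' -> z in C, z' <> z;
   the conjunct [C z] makes the cone empty off C. *)
Definition regular_normal_cone (R : realType) (n : nat) (C : set 'rV[R]_n)
    (z : 'rV[R]_n) : set 'rV[R]_n :=
  [set v | C z /\ forall e : R, 0 < e ->
     \forall z' \near z, C z' -> dot v (z' - z) <= e * enorm (z' - z)].

Definition dir_normal_cone (R : realType) (n : nat) (C : set 'rV[R]_n)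
    (z d : 'rV[R]_n) : set 'rV[R]_n :=
  [set v | exists (t : nat -> R) (dk vk : nat -> 'rV[R]_n),
     [/\ decreases_to0 t, dk @ \oo --> d, vk @ \oo --> v &
         forall k, regular_normal_cone C (z + t k *: dk k) (vk k)]].

Definition inner_dir_normal_cone (R : realType) (n : nat) (C : set 'rV[R]_n)
    (z d : 'rV[R]_n) : set 'rV[R]_n :=
  [set v | forall t : nat -> R, decreases_to0 t ->
     exists dk vk : nat -> 'rV[R]_n,
     [/\ dk @ \oo --> d, vk @ \oo --> v &
         forall k, regular_normal_cone C (z + t k *: dk k) (vk k)]].

Definition regular_in_dir (R : realType) (n : nat) (C : set 'rV[R]_n)
    (z d : 'rV[R]_n) : Prop :=
  dir_normal_cone C z d = inner_dir_normal_cone C z d.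

Definition dir_regular_at (R : realType) (n : nat) (C : set 'rV[R]_n)
    (z : 'rV[R]_n) : Prop :=
  forall d, regular_in_dir C z d.

Definition dir_regular (R : realType) (n : nat) (C : set 'rV[R]_n) : Prop :=
  forall z, C z -> dir_regular_at C z.

(* R^(n_0) x ... x R^(n_(m-1)) is identified with R^(n_0 + ... + n_(m-1)):
   the tuple (z_0, ..., z_(m-1)) is the block row [\mxrow_i z i], whose i-th
   block is recovered by [submxrow]. *)
Definition prod_set (R : realType) (m : nat) (n : 'I_m -> nat)
    (A : forall i : 'I_m, set 'rV[R]_(n i)) : set 'rV[R]_(\sum_(i < m) n i) :=
  [set z | forall i : 'I_m, A i (submxrow z i)].

Definition tangent_product_rule (R : realType) (m : nat) (n : 'I_m -> nat)
    (A : forall i : 'I_m, set 'rV[R]_(n i))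
    (z : forall i : 'I_m, 'rV[R]_(n i)) : Prop :=
  tangent_cone (prod_set A) (\mxrow_(i < m) z i)
  = prod_set (fun i => tangent_cone (A i) (z i)).

Definition normal_product_rule (R : realType) (m : nat) (n : 'I_m -> nat)
    (A : forall i : 'I_m, set 'rV[R]_(n i))
    (z d : forall i : 'I_m, 'rV[R]_(n i)) : Prop :=
  dir_normal_cone (prod_set A) (\mxrow_(i < m) z i) (\mxrow_(i < m) d i)
  = prod_set (fun i => dir_normal_cone (A i) (z i) (d i)).

(* Main.v *)
(* Regular normal cones of products are products, so inner directional normal
   cones of the factors combine (they share the sequence t), while directional
   normal cones of the product split; directional regularity closes the circle.
   It also makes every tangent vector derivable, whence the tangent rule.
   For C closed convex, v in N_C(z;d) is normal to C at z and orthogonal to d.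
   Projecting z + s (d + v) on C for each s gives z + s d' with normal
   v' = d + v - d'; since P_C(z + s (d + v)) = z + s d + o(s), d' -> d and
   v' -> v along every sequence s, so C is directionally regular. *)
Require Import Defs.
From mathcomp Require Import all_boot all_order all_algebra.
From mathcomp Require Import all_classical all_reals all_analysis.
From mathcomp Require Import ring lra.

Set Implicit Arguments.
Unset Strict Implicit.
Unset Printing Implicit Defensive.

Import Order.TTheory GRing.Theory Num.Theory.
Import numFieldNormedType.Exports.

Local Open Scope classical_set_scope.
Local Open Scope ring_scope.

(** * Euclidean inner product and norm *)

Section inner_product.
Context (R : realType) (n : nat).
Implicit Types (a : R) (u v w : 'rV[R]_n).

Lemma dotC u v : dot u v = dot v u.
Proof. by apply: eq_bigr => i _; rewrite mulrC. Qed.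

Lemma dotDl u v w : dot (u + v) w = dot u w + dot v w.
Proof. by rewrite -big_split; apply: eq_bigr => i _ /=; rewrite mxE mulrDl. Qed.

Lemma dotZl a u v : dot (a *: u) v = a * dot u v.
Proof. by rewrite mulr_sumr; apply: eq_bigr => i _; rewrite mxE mulrA. Qed.

Lemma dotNl u v : dot (- u) v = - dot u v.
Proof. by rewrite -scaleN1r dotZl mulN1r. Qed.

Lemma dot0l u : dot 0 u = 0.
Proof. by rewrite -(scale0r 0) dotZl mul0r. Qed.

Lemma dotDr u v w : dot u (v + w) = dot u v + dot u w.
Proof. by rewrite dotC dotDl !(dotC u). Qed.

Lemma dotZr a u v : dot u (a *: v) = a * dot u v.
Proof. by rewrite dotC dotZl dotC. Qed.

Lemma dotNr u v : dot u (- v) = - dot u v.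
Proof. by rewrite dotC dotNl dotC. Qed.

Lemma dot0r u : dot u 0 = 0.
Proof. by rewrite dotC dot0l. Qed.

Lemma dot_sqrD u v : dot (u + v) (u + v) = dot u u + 2 * dot u v + dot v v.
Proof. by rewrite dotDl !dotDr (dotC v u); ring. Qed.

Lemma dot_ge0 u : 0 <= dot u u.
Proof. by apply: sumr_ge0 => i _; rewrite -expr2 sqr_ge0. Qed.

Lemma sqr_coord_le_dot u i : u 0 i ^+ 2 <= dot u u.
Proof.
rewrite /dot (bigD1 i) //= -expr2 lerDl.
by apply: sumr_ge0 => j _; rewrite -expr2 sqr_ge0.
Qed.

Lemma enorm_ge0 u : 0 <= enorm u.
Proof. exact: sqrtr_ge0. Qed.

Lemma enormZ a u : 0 <= a -> enorm (a *: u) = a * enorm u.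
Proof.
move=> a0; rewrite /enorm dotZl dotZr mulrA -expr2 sqrtrM ?sqr_ge0//.
by rewrite sqrtr_sqr ger0_norm.
Qed.

Lemma normr_coord_le_enorm u i : `|u 0 i| <= enorm u.
Proof. by rewrite -sqrtr_sqr; apply: ler_wsqrtr; exact: sqr_coord_le_dot. Qed.

End inner_product.

(** * Entrywise and blockwise convergence *)

Section convergence.
Context (R : realType) (T : Type) (F : set_system T) {FF : Filter F}.

(** A neighbourhood of a matrix contains a product of neighbourhoods of its entries, and there are
    only finitely many entries to control. *)
Lemma cvg_coord p q (f : T -> 'M[R]_(p, q)) (x : 'M[R]_(p, q)) :
  (forall i j, f k i j @[k --> F] --> x i j) -> f @ F --> x.
Proof.
move=> fx A [P Px PA].
have: \forall k \near F, forall i j, P i j (f k i j).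
  by apply: filter_forall => i; apply: filter_forall => j; exact: fx (Px i j).
by apply: filterS => k; exact: PA.
Qed.

Lemma coord_cvg p q (f : T -> 'M[R]_(p, q)) (x : 'M[R]_(p, q)) i j :
  f @ F --> x -> f k i j @[k --> F] --> x i j.
Proof.
move=> fx; apply: (cvg_comp f (fun M : 'M[R]_(p, q) => M i j) fx).
exact: coord_continuous.
Qed.

Lemma dot_cvg n (f g : T -> 'rV[R]_n) (x y : 'rV[R]_n) :
  f @ F --> x -> g @ F --> y -> dot (f k) (g k) @[k --> F] --> dot x y.
Proof.
move=> fx gy; apply: cvg_big => [|i _]; first exact: add_continuous.
by apply: cvgM; exact: coord_cvg.
Qed.

Lemma submxrow_cvg m (n : 'I_m -> nat) (f : T -> 'rV[R]_(\sum_(i < m) n i))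
    (x : 'rV[R]_(\sum_(i < m) n i)) i :
  f @ F --> x -> submxrow (f k) i @[k --> F] --> submxrow x i.
Proof.
move=> fx; apply: cvg_coord => a b; rewrite /submxrow.
under eq_fun do rewrite mxE.
by rewrite mxE; exact: coord_cvg.
Qed.

Lemma mxrow_cvg m (n : 'I_m -> nat) (f : T -> forall i : 'I_m, 'rV[R]_(n i))
    (x : forall i : 'I_m, 'rV[R]_(n i)) :
  (forall i, f k i @[k --> F] --> x i) ->
  \mxrow_(i < m) f k i @[k --> F] --> \mxrow_(i < m) x i.
Proof.
move=> fx; apply: cvg_coord => a b.
under eq_fun do rewrite mxE.
by rewrite mxE; exact: coord_cvg.
Qed.

End convergence.

(** * Normal cones of products *)

Section product.
Context (R : realType) (m : nat) (n : 'I_m -> nat).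
Implicit Types z d u v : 'rV[R]_(\sum_(i < m) n i).

Lemma submxrowZ (a : R) v i : submxrow (a *: v) i = a *: submxrow v i.
Proof. by apply/matrixP => j k; rewrite !mxE. Qed.

(** Inherited from block multiplication: [dot x y] is the only entry of [x *m y^T]. *)
Lemma dot_mxrow u v :
  dot u v = \sum_(i < m) dot (submxrow u i) (submxrow v i).
Proof.
have dotE k (x y : 'rV[R]_k) : dot x y = (x *m y^T) 0 0.
  by rewrite mxE; apply: eq_bigr => i _; rewrite [y^T _ _]mxE.
rewrite dotE -{1}(submxrowK u) -{1}(submxrowK v) tr_mxrow mul_mxrow_mxcol.
by rewrite summxE; apply: eq_bigr => i _; rewrite dotE.
Qed.

Lemma enorm_submxrow_le u i : enorm (submxrow u i) <= enorm u.
Proof.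
apply: ler_wsqrtr; rewrite (dot_mxrow u) (bigD1 i) //= lerDl.
by apply: sumr_ge0 => j _; exact: dot_ge0.
Qed.

(** Perturbing one block at a time gives the inclusion into the factors; conversely, the [m] block
    inequalities add up, each block being no longer than the whole vector. *)
Lemma regular_normal_cone_prod (A : forall i : 'I_m, set 'rV[R]_(n i)) z :
  regular_normal_cone (prod_set A) z
  = prod_set (fun i => regular_normal_cone (A i) (submxrow z i)).
Proof.
apply/seteqP; split => [v [Az Hv] i|v Hv]; split.
- exact: Az.
- (* Test the inequality on points that differ from [z] in block [i] only. *)
  move=> e e0.
  pose f (x : 'rV[R]_(n i)) : 'rV[R]_(\sum_(i < m) n i) :=
    \mxrow_(j < m) dfwith (fun j => submxrow z j) i x j.
  have fz : f (submxrow z i) = z.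
    by rewrite -[RHS]submxrowK; apply: eq_mxrow => j; case: dfwithP.
  have fc : f x @[x --> submxrow z i] --> z.
    rewrite -[X in _ --> X]submxrowK.
    apply: (@mxrow_cvg _ _ (nbhs (submxrow z i))) => j.
    have [<-|ij] := eqVneq i j.
      by under eq_fun do rewrite dfwithin; exact: cvg_id.
    by under eq_fun do rewrite dfwithout//; exact: cvg_cst.
  have fi x : submxrow (f x - z) i = x - submxrow z i.
    by rewrite submxrowB mxrowK dfwithin.
  have fj x j : i != j -> submxrow (f x - z) j = 0.
    by move=> ij; rewrite submxrowB mxrowK dfwithout// subrr.
  have dotf w x : dot w (f x - z) = dot (submxrow w i) (x - submxrow z i).
    rewrite dot_mxrow (bigD1 i)//= fi big1 ?addr0// => j.
    by rewrite eq_sym => /fj ->; rewrite dot0r.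
  have : \forall x \near submxrow z i, prod_set A (f x) ->
      dot v (f x - z) <= e * enorm (f x - z) by exact: fc (Hv e e0).
  apply: filterS => x Hx Ax.
  have -> : enorm (x - submxrow z i) = enorm (f x - z).
    by rewrite /enorm dotf fi.
  rewrite -dotf; apply: Hx => j; rewrite mxrowK.
  by case: dfwithP.
- by move=> i; have [] := Hv i.
- move=> e e0.
  (* Each of the [m] blocks gets an equal share of [e]; dividing by [m.+1] keeps the share defined
     and positive when [m = 0]. *)
  have e'0 : 0 < e / m.+1%:R by rewrite divr_gt0.
  have : \forall x \near z, forall i, A i (submxrow x i) ->
      dot (submxrow v i) (submxrow x i - submxrow z i)
      <= e / m.+1%:R * enorm (submxrow x i - submxrow z i).
    apply: (@filter_forall _ _ _ (nbhs z)) => i.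
    have [_ /(_ _ e'0)] := Hv i.
    exact: (@submxrow_cvg R _ (nbhs z) _ m n id z i (@cvg_id _ _)).
  apply: filterS => x Hx Ax.
  rewrite dot_mxrow.
  apply: (@le_trans _ _ (\sum_(i < m) e / m.+1%:R * enorm (x - z))).
    apply: ler_sum => i _; rewrite submxrowB; apply: le_trans (Hx i (Ax i)) _.
    by rewrite ler_pM2l// -submxrowB enorm_submxrow_le.
  rewrite sumr_const card_ord -[leLHS]mulr_natr mulrAC.
  apply: ler_wpM2r; first exact: enorm_ge0.
  by rewrite -mulrA ger_pMr// ler_pdivrMl// mulr1 ler_nat.
Qed.

(** Cut the sequences into blocks, keeping [t]. This cannot be reversed directly, since the
    sequences [t] of different factors need not agree. *)
Lemma dir_normal_cone_prod_sub (A : forall i : 'I_m, set 'rV[R]_(n i)) z d :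
  dir_normal_cone (prod_set A) z d `<=`
  prod_set (fun i => dir_normal_cone (A i) (submxrow z i) (submxrow d i)).
Proof.
move=> v [t [dk [vk [t0 dkd vkv H]]]] i.
exists t, (fun k => submxrow (dk k) i), (fun k => submxrow (vk k) i).
split => //; [exact: submxrow_cvg|exact: submxrow_cvg|move=> k].
by move: (H k); rewrite regular_normal_cone_prod => /(_ i);
  rewrite submxrowD submxrowZ.
Qed.

(** Inner normals exist along every [t], so the same [t] can be imposed on all factors and the
    chosen blocks glued. *)
Lemma prod_inner_dir_normal_cone_sub
    (A : forall i : 'I_m, set 'rV[R]_(n i)) z d :
  prod_set (fun i => inner_dir_normal_cone (A i) (submxrow z i) (submxrow d i))
  `<=` inner_dir_normal_cone (prod_set A) z d.
Proof.
move=> v Hv t t0.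
pose dk i := projT1 (cid (Hv i t t0)).
pose vk i := projT1 (cid (projT2 (cid (Hv i t t0)))).
have H i : [/\ dk i @ \oo --> submxrow d i, vk i @ \oo --> submxrow v i &
    forall k,
      regular_normal_cone (A i) (submxrow z i + t k *: dk i k) (vk i k)].
  exact: projT2 (cid (projT2 (cid (Hv i t t0)))).
exists (fun k => \mxrow_(i < m) dk i k), (fun k => \mxrow_(i < m) vk i k).
split => [| |k].
- by rewrite -(submxrowK d); apply: mxrow_cvg => i; case: (H i).
- by rewrite -(submxrowK v); apply: mxrow_cvg => i; case: (H i).
- rewrite regular_normal_cone_prod => i.
  by rewrite submxrowD submxrowZ !mxrowK; case: (H i).
Qed.

End product.

(** * Product rules under directional regularity *)

Lemma decreases_to0_harmonic (R : realType) : decreases_to0 (@harmonic R).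
Proof. by split => [k|]; [exact: harmonic_gt0|exact: cvg_harmonic]. Qed.

Lemma inner_dir_normal_cone_sub (R : realType) n (C : set 'rV[R]_n) z d :
  inner_dir_normal_cone C z d `<=` dir_normal_cone C z d.
Proof.
move=> v /(_ _ (@decreases_to0_harmonic R))[dk [vk H]].
have [H1 H2 H3] := H.
exists harmonic, dk, vk; split => //; exact: decreases_to0_harmonic.
Qed.

Lemma regular_in_dir_prod (R : realType) (m : nat) (n : 'I_m -> nat)
    (A : forall i : 'I_m, set 'rV[R]_(n i)) (z d : 'rV[R]_(\sum_(i < m) n i)) :
  (forall i, regular_in_dir (A i) (submxrow z i) (submxrow d i)) ->
  regular_in_dir (prod_set A) z d /\
  dir_normal_cone (prod_set A) z d
  = prod_set (fun i => dir_normal_cone (A i) (submxrow z i) (submxrow d i)).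
Proof.
move=> regA.
have sub :
    prod_set (fun i => dir_normal_cone (A i) (submxrow z i) (submxrow d i))
    `<=` inner_dir_normal_cone (prod_set A) z d.
  move=> v Hv; apply: prod_inner_dir_normal_cone_sub => i.
  by rewrite -regA; exact: Hv.
split; apply/seteqP; split => v Hv.
- by apply: sub; exact: dir_normal_cone_prod_sub.
- exact: inner_dir_normal_cone_sub.
- exact: dir_normal_cone_prod_sub.
- by apply: inner_dir_normal_cone_sub; exact: sub.
Qed.

Lemma regular_normal_cone0 (R : realType) n (C : set 'rV[R]_n) z :
  C z -> regular_normal_cone C z 0.
Proof.
move=> Cz; split => // e e0; near=> x => _.
by rewrite dot0l mulr_ge0 ?enorm_ge0// ltW.
Unshelve. all: by end_near. Qed.

(* [0] is a regular normal at every point of [C], so regularity at [z] turns a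
   single sequence realizing [d] into one for every prescribed [t]. *)
Lemma dir_regular_at_derivable (R : realType) n (C : set 'rV[R]_n) z d :
  dir_regular_at C z -> tangent_cone C z d ->
  forall t : nat -> R, decreases_to0 t -> exists w : nat -> 'rV[R]_n,
    w @ \oo --> d /\ forall k, C (z + t k *: w k).
Proof.
move=> regC [t0 [w0 [t00 w0d Cw0]]] t tto0.
have : inner_dir_normal_cone C z d 0.
  rewrite -regC; exists t0, w0, (fun=> 0); split => // [|k].
    exact: cvg_cst.
  exact: regular_normal_cone0.
by move=> /(_ t tto0)[w [v [wd _ Cw]]]; exists w; split => // k; case: (Cw k).
Qed.

Lemma tangent_cone_prod (R : realType) (m : nat) (n : 'I_m -> nat)
    (A : forall i : 'I_m, set 'rV[R]_(n i)) (z : 'rV[R]_(\sum_(i < m) n i)) :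
  (forall i, dir_regular_at (A i) (submxrow z i)) ->
  tangent_cone (prod_set A) z
  = prod_set (fun i => tangent_cone (A i) (submxrow z i)).
Proof.
move=> regA; apply/seteqP; split => d.
  move=> [t [w [t0 wd Aw]]] i; exists t, (fun k => submxrow (w k) i).
  split => // [|k]; first exact: submxrow_cvg.
  by have := Aw k i; rewrite submxrowD submxrowZ.
move=> Td.
(* Regularity lets all factors realize their tangents along one common sequence, here the harmonic
   one. *)
have H i := dir_regular_at_derivable (regA i) (Td i)
  (@decreases_to0_harmonic R).
pose w i := projT1 (cid (H i)).
have Hw i : w i @ \oo --> submxrow d i /\
    forall k, A i (submxrow z i + harmonic k *: w i k).
  exact: projT2 (cid (H i)).
exists harmonic, (fun k => \mxrow_(i < m) w i k); split => [| |k i].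
- exact: decreases_to0_harmonic.
- by rewrite -(submxrowK d); apply: mxrow_cvg => i; case: (Hw i).
- by rewrite submxrowD submxrowZ mxrowK; case: (Hw i).
Qed.

(** * Normals of convex sets and projection onto them *)

Section convex.
Context (R : realType) (n : nat) (C : set 'rV[R]_n).
Context (convC : @convex_set R 'rV[R]_n C).
Implicit Types x y z u v d c : 'rV[R]_n.

Lemma convex_segment x y (l : R) :
  C x -> C y -> 0 <= l -> l <= 1 -> C (x + l *: (y - x)).
Proof.
move=> Cx Cy l0 l1.
have -> : x + l *: (y - x) = l *: y + (1 - l) *: x.
  by rewrite scalerBr scalerBl scale1r addrCA.
have := @convC y x (Itv01 l0 l1).
by rewrite !in_setE; exact.
Qed.

(** On a segment from [x] to [c] in [C], both sides of the local inequality scale with the step [l],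
    so a bound near [x] already holds at [c]. *)
Lemma regular_normal_cone_convexP x v :
  regular_normal_cone C x v <-> C x /\ forall c, C c -> dot v (c - x) <= 0.
Proof.
split => -[Cx Hv]; split => //; last first.
  move=> e e0; near=> c => Cc; apply: le_trans (Hv c Cc) _.
  by rewrite mulr_ge0 ?enorm_ge0// ltW.
move=> c Cc; rewrite leNgt; apply/negP => v0.
pose E := enorm (c - x).
have E0 : 0 <= E by exact: enorm_ge0.
(* Chosen so that [e * E < dot v (c - x)]; the added 1 also keeps the denominator positive. *)
pose e := dot v (c - x) / (E + 1).
have e0 : 0 < e by rewrite divr_gt0// ltr_wpDl.
have fc : x + l *: (c - x) @[l --> 0^'+] --> x.
  rewrite -[X in _ --> X]addr0 -(scale0r (c - x)).
  apply: cvgD; first exact: cvg_cst.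
  apply: cvgZr_tmp; exact: cvg_at_right_filter cvg_id.
have [l [l0 [l1 Hl]]] : exists l : R, 0 < l /\ l <= 1 /\
    (C (x + l *: (c - x)) ->
     dot v (x + l *: (c - x) - x) <= e * enorm (x + l *: (c - x) - x)).
  apply: (@filter_ex _ (0^'+ : set_system R)); near=> l.
  split; [|split]; near: l.
  - exact: nbhs_right_gt.
  - exact: nbhs_right_le.
  - exact: fc (Hv e e0).
move: (Hl (convex_segment Cx Cc (ltW l0) l1)).
rewrite [x + _]addrC addrK dotZr (enormZ _ (ltW l0)) mulrCA ler_pM2l// -/E.
rewrite /e mulrAC ler_pdivlMr ?ltr_wpDl// ler_pM2l//.
by rewrite leNgt ltrDl ltr01.
Unshelve. all: by end_near. Qed.

(** Minimize over the points of [C] no farther from [u] than [c0]: they form a closed subset of a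
    box of half-width [M] around [u], hence a compact set. *)
Lemma projection_exists u : closed C -> C !=set0 ->
  exists p, C p /\ forall c, C c -> dot (u - p) (u - p) <= dot (u - c) (u - c).
Proof.
move=> clC [c0 Cc0].
pose g x := dot (u - x) (u - x).
have gc : continuous g.
  have ux x : u - y @[y --> x] --> u - x.
    exact: (@cvgB _ _ _ (nbhs x) _ _ _ _ _ (cvg_cst u) (@cvg_id _ _)).
  by move=> x; exact: (@dot_cvg _ _ (nbhs x) _ _ _ _ _ _ (ux x) (ux x)).
pose K := C `&` [set x | g x <= g c0].
pose M := enorm (u - c0).
have cK : compact K.
  apply: (@subclosed_compact _ _
    [set x : 'rV[R]_n | forall i, `[u 0 i - M, u 0 i + M]%classic (x 0 i)]).
  - apply: closedI => //.
    exact: (closed_comp (fun x _ => gc x) (@closed_le _ (g c0))).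
  - exact: (@rV_compact R n _ (fun i => @segment_compact R _ _)).
  - move=> x [_ /= gx] i.
    have uxM : enorm (u - x) <= M by exact: ler_wsqrtr.
    have := le_trans (normr_coord_le_enorm (u - x) i) uxM.
    by rewrite !mxE ler_norml in_itv/= => /andP[? ?]; apply/andP; split; lra.
have [||p] := @EVT_min_rV R n g K _ cK; first by exists c0; split => //=.
  exact: continuous_subspaceT.
rewrite in_setE => -[Cp gp] pmin; exists p; split => // c Cc.
have [gcc|/ltW gcc] := leP (g c) (g c0); last exact: le_trans gp gcc.
by apply: pmin; rewrite in_setE.
Qed.

Lemma projection_variational u p c :
  C p -> (forall c, C c -> dot (u - p) (u - p) <= dot (u - c) (u - c)) ->
  C c -> dot (u - p) (c - p) <= 0.
Proof.
move=> Cp pmin Cc; rewrite leNgt; apply/negP => a0.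
set a := dot (u - p) (c - p) in a0.
pose b := dot (c - p) (c - p).
have b0 : 0 <= b by exact: dot_ge0.
(* Moving from [p] towards [c] by [l] changes the squared distance by
   [l (l b - 2 a)], which is negative for this choice of [l]. *)
pose l := a / (a + b).
have ab0 : 0 < a + b by rewrite ltr_pwDl.
have l0 : 0 < l by rewrite divr_gt0.
have l1 : l <= 1 by rewrite ler_pdivrMr// mul1r lerDl.
have lb : l * b <= a by rewrite mulrAC ler_pdivrMr// ler_pM2l// lerDr ltW.
have := pmin _ (convex_segment Cp Cc (ltW l0) l1).
rewrite opprD addrA [leRHS]dot_sqrD !(dotNl, dotNr, dotZl, dotZr) -/a -/b.
by move=> ?; nra.
Qed.

End convex.

(** * Directional regularity of closed convex sets *)

Section convex_regular.
Context (R : realType) (n : nat) (C : set 'rV[R]_n).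

(* The estimate behind [d' -> d] for the scaled projection [z + s d'] of
   [z + s (d + v)]: it involves [s] only through [w], which by convexity may be
   any vector with [z + t w] in [C] for some [t >= s]. *)
Lemma projection_direction_le (d d' v w : 'rV[R]_n) :
  dot v d = 0 -> dot v d' <= 0 -> dot (d + v - d') (w - d') <= 0 ->
  dot (d - d') (d - d') <= dot (w - d) (w - d) - 2 * dot v (w - d).
Proof.
move=> vd vd'.
have -> : d + v - d' = (d - d') + v by rewrite addrAC.
have -> : w - d' = (d - d') + (w - d) by rewrite [RHS]addrC addrA subrK.
have : dot v (d - d') = - dot v d' by rewrite dotDr dotNr vd add0r.
move: (d - d') (w - d) => a b va.
have := dot_ge0 (a + b).
rewrite dot_sqrD dotDl !dotDr va; lra.
Qed.

Lemma dir_normal_cone_convex z d v :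
  @convex_set R 'rV[R]_n C -> C z -> dir_normal_cone C z d v ->
  (forall c, C c -> dot v (c - z) <= 0) /\ dot v d = 0.
Proof.
move=> convC Cz [t [w [vk [[t0 tto0] wd vkv H]]]].
have {}H k := (regular_normal_cone_convexP convC _ _).1 (H k).
have xz : z + t k *: w k @[k --> \oo] --> z.
  rewrite -[X in _ --> X]addr0 -(scale0r d).
  by apply: cvgD; [exact: cvg_cst|exact: cvgZ].
have vN c : C c -> dot v (c - z) <= 0.
  move=> Cc; have cxz : c - (z + t k *: w k) @[k --> \oo] --> c - z.
    by apply: cvgB => //; exact: cvg_cst.
  apply: (cvgr_to_le (dot_cvg vkv cxz)).
  by near=> k; have [_] := H k; exact.
(* For [<=], test [v] at the base points [z + t k *: w k]; for [>=], test [vk k] at [z] and pass to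
   the limit. *)
split => //; apply/eqP; rewrite eq_le; apply/andP; split.
- have vw : dot v (w k) @[k --> \oo] --> dot v d.
    by apply: dot_cvg => //; exact: cvg_cst.
  apply: (cvgr_to_le vw); near=> k.
  have [/vN + _] := H k.
  by rewrite [z + _]addrC addrK dotZr pmulr_rle0.
- apply: (cvgr_to_ge (dot_cvg vkv wd)); near=> k.
  have [_ /(_ _ Cz)] := H k.
  by rewrite opprD addNKr dotNr dotZr oppr_le0 pmulr_rge0.
Unshelve. all: by end_near. Qed.

Lemma dir_regular_convex :
  closed C -> @convex_set R 'rV[R]_n C -> dir_regular C.
Proof.
move=> clC convC z Cz d; apply/seteqP; split; last first.
  exact: inner_dir_normal_cone_sub.
move=> v Nv; have [vN vd0] := dir_normal_cone_convex convC Cz Nv.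
have [t [w [vk [[t0 _] wd _ Hw]]]] := Nv.
have {}Hw k : C (z + t k *: w k) by case: (Hw k).
move=> s [s0 sto0].
have [p Hp] : exists p : nat -> 'rV[R]_n, forall k, C (p k) /\
    forall c, C c -> dot (z + s k *: (d + v) - p k) (c - p k) <= 0.
  have [|p Hp] := @choice _ _ (fun k (pk : 'rV[R]_n) => C pk /\
    forall c, C c -> dot (z + s k *: (d + v) - pk) (c - pk) <= 0);
    last by exists p.
  move=> k.
  have [|q [Cq qmin]] := projection_exists (z + s k *: (d + v)) clC.
    by exists z.
  by exists q; split => // c; exact: projection_variational.
(* The direction for which the projection [p k] is exactly [z + s k *: d' k]. *)
pose d' k := (s k)^-1 *: (p k - z).
have pE k : p k = z + s k *: d' k.
  by rewrite scalerA divff ?gt_eqF// scale1r addrC subrK.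
(* The variational inequality of the projection, divided by [s k ^+ 2]. *)
have var k c : C (z + s k *: c) -> dot (d + v - d' k) (c - d' k) <= 0.
  move=> /(Hp k).2; rewrite pE !opprD !addrA ![z + _ - z]addrAC subrr !add0r.
  by rewrite -!scalerBr dotZl dotZr !pmulr_rle0.
have d'd : d' @ \oo --> d.
  apply: cvg_coord => i j; rewrite (ord1 i).
  apply/cvgrPdist_lt => e e0.
  have wd0 : w k - d @[k --> \oo] --> (0 : 'rV[R]_n).
    by rewrite -(subrr d); apply: cvgB => //; exact: cvg_cst.
  have bound : dot (w k - d) (w k - d) - 2 * dot v (w k - d) @[k --> \oo]
      --> (0 : R).
    have -> : (0 : R) = dot 0 (0 : 'rV[R]_n) - 2 * dot v 0.
      by rewrite !dot0r mulr0 subr0.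
    apply: cvgB; first exact: dot_cvg.
    by apply: cvgMl_tmp; apply: dot_cvg => //; exact: cvg_cst.
  (* Freeze one index [K] of the given sequence with a small enough bound; only [k] then tends to
     infinity. *)
  have [K HK] : exists K,
      dot (w K - d) (w K - d) - 2 * dot v (w K - d) < e ^+ 2.
    apply: (@filter_ex _ (\oo : set_system nat)).
    by apply: cvgr_lt bound _ _; rewrite exprn_gt0.
  near=> k.
  have sk : s k <= t K by near: k; apply: cvgr_le sto0 _ _.
  (* Since [s k <= t K], this point lies on the segment from [z] to [z + t K *: w K]. *)
  have CwK : C (z + s k *: w K).
    have := convex_segment convC Cz (Hw K) _ _ (l := s k / t K).
    rewrite [z + _ - z]addrAC subrr add0r scalerA divfK ?gt_eqF//; apply.
      by rewrite divr_ge0 ?ltW.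
    by rewrite ler_pdivrMr// mul1r.
  have vd' : dot v (d' k) <= 0.
    have := vN _ (Hp k).1; rewrite pE [z + _]addrC addrK dotZr.
    by rewrite pmulr_rle0.
  have := le_lt_trans (projection_direction_le vd0 vd' (var _ _ CwK)) HK.
  move=> /(le_lt_trans (sqr_coord_le_dot _ j)).
  by rewrite !mxE -real_normK ?num_real// ltr_pXn2r ?nnegrE// ltW.
(* The normal is the projection residual divided by [s k]; it tends to [v] because [d'] tends to
   [d]. *)
exists d', (fun k => d + v - d' k); split => // [|k].
  rewrite -[X in _ --> X](addrK d) [v + d]addrC.
  by apply: cvgB => //; exact: cvg_cst.
apply/(regular_normal_cone_convexP convC); rewrite -pE; split.
  by case: (Hp k).
move=> c Cc.
(* Any [c] in [C] has the form required by [var] after rescaling around [z]. *)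
have cE : c = z + s k *: ((s k)^-1 *: (c - z)).
  by rewrite scalerA divff ?gt_eqF// scale1r addrC subrK.
have := var k ((s k)^-1 *: (c - z)); rewrite -cE => /(_ Cc).
by rewrite /d' -scalerBr dotZr opprB addrA subrK pmulr_rle0 ?invr_gt0.
Unshelve. all: by end_near. Qed.

End convex_regular.

Theorem corollary3p2 (R : realType) (m : nat) (n : 'I_m -> nat)
    (A : forall i : 'I_m, set 'rV[R]_(n i)) :
  (forall z d : (forall i : 'I_m, 'rV[R]_(n i)),
     (forall i, A i (z i)) ->
     (forall i, regular_in_dir (A i) (z i) (d i)) ->
     regular_in_dir (prod_set A) (\mxrow_(i < m) z i) (\mxrow_(i < m) d i) /\
     normal_product_rule A z d) /\
  (forall z : (forall i : 'I_m, 'rV[R]_(n i)),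
     (forall i, A i (z i)) ->
     (forall i, dir_regular_at (A i) (z i)) ->
     [/\ dir_regular_at (prod_set A) (\mxrow_(i < m) z i),
         tangent_product_rule A z &
         forall d : (forall i : 'I_m, 'rV[R]_(n i)),
           normal_product_rule A z d]) /\
  ((forall i, closed (A i)) ->
   (forall i, @convex_set R 'rV[R]_(n i) (A i)) ->
   dir_regular (prod_set A) /\
   (forall z : (forall i : 'I_m, 'rV[R]_(n i)),
      (forall i, A i (z i)) ->
      tangent_product_rule A z /\
      forall d : (forall i : 'I_m, 'rV[R]_(n i)),
        normal_product_rule A z d)).
Proof.
have part_i z d : (forall i, regular_in_dir (A i) (z i) (d i)) ->
    regular_in_dir (prod_set A) (\mxrow_(i < m) z i) (\mxrow_(i < m) d i) /\
    normal_product_rule A z d.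
  move=> regA; have [|regP NP] := @regular_in_dir_prod R m n A
    (\mxrow_(i < m) z i) (\mxrow_(i < m) d i).
    by move=> i; rewrite !mxrowK.
  split => //; rewrite /normal_product_rule NP; congr prod_set.
  by apply: functional_extensionality_dep => i; rewrite !mxrowK.
have part_ii z : (forall i, dir_regular_at (A i) (z i)) ->
    [/\ dir_regular_at (prod_set A) (\mxrow_(i < m) z i),
        tangent_product_rule A z &
        forall d : (forall i : 'I_m, 'rV[R]_(n i)), normal_product_rule A z d].
  move=> regA; split.
  (* Every direction in the product space is the block row of its blocks, so (i) covers all of
     them. *)
  - move=> d; rewrite -(submxrowK d).
    by apply: (part_i z _ _).1 => i; exact: regA.
  - rewrite /tangent_product_rule tangent_cone_prod.
      congr prod_set; apply: functional_extensionality_dep => i.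
      by rewrite mxrowK.
    by move=> i; rewrite mxrowK; exact: regA.
  - by move=> d; apply: (part_i z d _).2 => i; exact: regA.
split; first by move=> z d _; exact: part_i.
split; first by move=> z _; exact: part_ii.
move=> clA convA.
(* Convexity enters only through the regularity of each factor; the rest is (ii). *)
have regA i : dir_regular (A i) by exact: dir_regular_convex.
split=> [z Az|z Az].
  rewrite -(submxrowK z).
  by have [] := part_ii (fun i => submxrow z i) (fun i => regA i _ (Az i)).
by have [_ ? ?] := part_ii z (fun i => regA i _ (Az i)).
Qed.
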